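(* Let $A(t)=(A_{I,J}(t))_{I,J\in V}$, $t\in[0,\infty)$, be a family of symmetric complex $n\times n$ matrices indexed by the fixed vertex set $V$, and let $\mathbb{L}(t)$ be the associated non-autonomous $p$-adic Laplacian on $L^2(K_N,\mathbb{C})$. If $t\mapsto A_{I,J}(t)$ is uniformly continuous on $[0,\infty)$ for each $I,J\in V$, then $t\mapsto\mathbb{L}(t)$ is strongly continuous, that is, for every $u\in L^2(K_N,\mathbb{C})$ the map $t\mapsto\mathbb{L}(t)u$ is a continuous function from $[0,\infty)$ to $L^2(K_N,\mathbb{C})$.
   Context: $p$ is a prime, $\mathbb{Q}_p$ the field of $p$-adic numbers with absolute value $|\cdot|_p$, and $dx$ the Haar measure on $\mathbb{Q}_p$ normalised by $\int_{\mathbb{Z}_p}dx=1$. $V\subset\mathbb{Q}_p$ is a set of $n$ points (the vertices of a weighted graph $\mathcal{G}_t$ whose vertex set does not depend on $t$ and whose adjacency matrix is $A(t)$), each of the form $I=I_0+I_1p+\dots+I_{N-1}p^{N-1}$ with digits $I_i\in\{0,\dots,p-1\}$, where $N$ is fixed so that the balls $B_{p^{-N}}(I)=\{x\in\mathbb{Q}_p:|x-I|_p\le p^{-N}\}$, $I\in V$, are pairwise disjoint. Put $K_N=\bigsqcup_{I\in V}B_{p^{-N}}(I)$ and let $\Omega_{I,N}$ be the indicator function of $B_{p^{-N}}(I)$. The kernel function is $A(x,y,t)=p^N\sum_{I,J\in V}A_{I,J}(t)\Omega_{I,N}(x)\Omega_{J,N}(y)$, the degrees are $\gamma_I(t)=\sum_{J\in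 V}A_{I,J}(t)$, and $\gamma(t)(x)=\sum_{I\in V}\gamma_I(t)\Omega_{I,N}(x)$. The $p$-adic Laplacian is the bounded operator $$\mathbb{L}(t)u(x)=\int_{K_N}A(x,y,t)u(y)\,dy-\gamma(t)(x)u(x),\qquad u\in L^2(K_N,\mathbb{C}).$$ *)

(* Defs.v *)
From HB Require Import structures.
From mathcomp Require Import all_boot all_order all_algebra.
From mathcomp Require Import complex.
From mathcomp Require Import all_classical all_reals all_analysis.
From mathcomp Require Import measurable_realfun zify ring lra.
Set Implicit Arguments.
Unset Strict Implicit.
Unset Printing Implicit Defensive.
Import Order.TTheory GRing.Theory Num.Theory.
Import numFieldNormedType.Exports.
Import Normc.
Local Open Scope classical_set_scope.
Local Open Scope ring_scope.
Local Open Scope quotient_scope.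

(* The p-adic absolute value on the rationals: |a / b|_p = p ^ (v_p(b) - v_p(a)) *)
Definition padic_val (p : nat) (x : rat) : int :=
  (logn p `|numq x|)%:Z - (logn p `|denq x|)%:Z.

Definition padic_abs (p : nat) (x : rat) : rat :=
  if x == 0 then 0 else p%:Q ^ (- padic_val p x).

Section PadicAbs.
Variables (p : nat) (p_pr : prime p).
Implicit Types x y : rat.
Local Notation abs := (padic_abs p).

Lemma padic_valE (a b : int) : a != 0 -> b != 0 ->
  padic_val p (a%:Q / b%:Q) = (logn p `|a|)%:Z - (logn p `|b|)%:Z.
Proof.
move=> a0 b0; set x := a%:Q / b%:Q.
have bQ : b%:Q != 0 by rewrite intr_eq0.
have x0 : x != 0 by rewrite mulf_neq0 ?invr_eq0 ?intr_eq0.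
have e : numq x * b = a * denq x.
  have xb : x * b%:Q = a%:Q by rewrite divfK.
  by apply/(@intr_inj rat); rewrite !intrM numqE mulrAC xb.
have {e} : logn p (`|numq x| * `|b|) = logn p (`|a| * `|denq x|).
  by rewrite -!abszM e.
rewrite !lognM ?absz_gt0 ?numq_eq0 ?denq_neq0// /padic_val => e; lia.
Qed.

Lemma padic_valM x y : x != 0 -> y != 0 ->
  padic_val p (x * y) = padic_val p x + padic_val p y.
Proof.
move=> x0 y0; rewrite -{1}[x]divq_num_den -{1}[y]divq_num_den mulf_div -!intrM.
rewrite padic_valE ?mulf_neq0 ?numq_eq0 ?denq_neq0//.
rewrite !abszM !lognM ?absz_gt0 ?numq_eq0 ?denq_neq0// /padic_val; lia.
Qed.

Lemma padic_valD x y : x != 0 -> y != 0 -> x + y != 0 ->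
  Num.min (padic_val p x) (padic_val p y) <= padic_val p (x + y).
Proof.
move=> x0 y0 xy0.
have E : x + y = (numq x * denq y + numq y * denq x)%:Q / (denq x * denq y)%:Q.
  rewrite -{1}[x]divq_num_den -{1}[y]divq_num_den addf_div ?intr_eq0 ?denq_neq0//.
  by rewrite intrD !intrM.
have n0 : numq x * denq y + numq y * denq x != 0.
  apply: contra_neq xy0 => n0; by rewrite E n0 mul0r.
rewrite E padic_valE ?mulf_neq0 ?denq_neq0//.
rewrite abszM lognM ?absz_gt0 ?denq_neq0// /padic_val.
set k := minn (logn p `|numq x| + logn p `|denq y|)
              (logn p `|numq y| + logn p `|denq x|).
suff : (k <= logn p `|(numq x * denq y + numq y * denq x)%R|)%N.
  rewrite /k ge_min; lia.
rewrite -pfactor_dvdn ?absz_gt0// -[(_ %| _)%N]/((p ^ k)%:Z %| _)%Z.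
have H (u v : int) : u != 0 -> v != 0 -> (k <= logn p `|u| + logn p `|v|)%N ->
    u * v \in dvdz (p ^ k)%N%:Z.
  move=> u0 v0 kuv; rewrite -[_ \in _]/(p ^ k %| `|(u * v)%R|)%N.
  by rewrite abszM pfactor_dvdn ?muln_gt0 ?absz_gt0 ?u0// lognM ?absz_gt0.
by apply: rpredD; apply: H; rewrite ?numq_eq0 ?denq_neq0// /k ?geq_minl ?geq_minr.
Qed.

Let p_gt0 : 0 < p%:Q. Proof. by rewrite ltr0n prime_gt0. Qed.
Let p_gt1 : 1 < p%:Q. Proof. by rewrite ltr1n prime_gt1. Qed.

Lemma padic_abs0 : abs 0 = 0. Proof. by rewrite /padic_abs eqxx. Qed.

Lemma padic_abs_gt0 x : x != 0 -> 0 < abs x.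
Proof. by move=> x0; rewrite /padic_abs (negbTE x0) exprz_gt0. Qed.

Lemma padic_abs_ge0 x : 0 <= abs x.
Proof.
by have [->|/padic_abs_gt0/ltW//] := eqVneq x 0; rewrite padic_abs0.
Qed.

Lemma padic_abs_eq0 x : (abs x == 0) = (x == 0).
Proof.
have [->|x0] := eqVneq x 0; first by rewrite padic_abs0 eqxx.
by rewrite gt_eqF ?padic_abs_gt0.
Qed.

Lemma padic_absM x y : abs (x * y) = abs x * abs y.
Proof.
have [->|x0] := eqVneq x 0; first by rewrite mul0r padic_abs0 mul0r.
have [->|y0] := eqVneq y 0; first by rewrite mulr0 padic_abs0 mulr0.
rewrite /padic_abs mulf_eq0 (negbTE x0) (negbTE y0) /= padic_valM//.
by rewrite opprD expfzDr// gt_eqF.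
Qed.

Lemma padic_absN x : abs (- x) = abs x.
Proof. by rewrite /padic_abs oppr_eq0 /padic_val numqN denqN abszN. Qed.

Lemma padic_abs1 : abs 1 = 1.
Proof. by rewrite /padic_abs oner_eq0 /padic_val !logn1 subrr oppr0 expr0z. Qed.

Lemma padic_absV x : abs x^-1 = (abs x)^-1.
Proof.
have [->|x0] := eqVneq x 0; first by rewrite padic_abs0 !invr0 padic_abs0.
apply: (@mulfI _ (abs x)); rewrite ?padic_abs_eq0//.
by rewrite -padic_absM mulfV// padic_abs1 mulfV// padic_abs_eq0.
Qed.

Lemma padic_absD_max x y : abs (x + y) <= Num.max (abs x) (abs y).
Proof.
have [->|x0] := eqVneq x 0; first by rewrite add0r le_max lexx orbT.
have [->|y0] := eqVneq y 0; first by rewrite addr0 le_max lexx.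
have [->|xy0] := eqVneq (x + y) 0; first by rewrite padic_abs0 le_max padic_abs_ge0.
have := padic_valD x0 y0 xy0.
rewrite /padic_abs (negbTE x0) (negbTE y0) (negbTE xy0).
by rewrite le_max ge_min => /orP[] h; apply/orP; [left|right];
   rewrite ler_eXz2l// lerN2.
Qed.

Lemma padic_absB_max x y : abs (x - y) <= Num.max (abs x) (abs y).
Proof. by rewrite -(padic_absN y) padic_absD_max. Qed.

Lemma padic_absB_eq x y : abs (x - y) < abs y -> abs x = abs y.
Proof.
move=> h; apply/eqP; rewrite eq_le; apply/andP; split.
  have := padic_absD_max (x - y) y; rewrite subrK => /le_trans; apply.
  by rewrite ge_max lexx ltW.
have := padic_absB_max x (x - y); rewrite subKr => h2.
by move: h2; rewrite le_max => /orP[//|]; rewrite leNgt h.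
Qed.

End PadicAbs.

(* Q_p is the completion of rat for padic_abs: the ring of Cauchy sequences
   modulo the ideal of null sequences *)
Definition padic_cauchy_prop (p : nat) (x : nat -> rat) :=
  forall e : rat, 0 < e -> exists N : nat, forall m n : nat,
    (N <= m)%N -> (N <= n)%N -> padic_abs p (x m - x n) < e.

Definition padic_null_prop (p : nat) (x : nat -> rat) :=
  forall e : rat, 0 < e -> exists N : nat, forall n : nat,
    (N <= n)%N -> padic_abs p (x n) < e.

Section CauchySeq.
Variables (p : nat) (p_pr : prime p).
Local Notation abs := (padic_abs p).

(* The proof that p is prime is kept as an argument so that the ring structures
   below, which exist only for p prime, can be inferred *)
Definition padic_cauchy (_ : prime p) : {pred nat -> rat} :=
  fun x => `[< padic_cauchy_prop p x >].

Lemma padic_cauchy_bounded x : padic_cauchy_prop p x ->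
  exists2 M, 0 < M & forall n, abs (x n) <= M.
Proof.
move=> /(_ _ ltr01)[N hN].
exists (1 + \sum_(i < N.+1) abs (x i)).
  by rewrite ltr_wpDr// sumr_ge0// => i _; rewrite padic_abs_ge0.
have le i : (i < N.+1)%N -> abs (x i) <= \sum_(i < N.+1) abs (x i).
  move=> iN; rewrite (bigD1 (Ordinal iN))//= lerDl sumr_ge0// => j _.
  by rewrite padic_abs_ge0.
have s0 : 0 <= \sum_(i < N.+1) abs (x i).
  by rewrite sumr_ge0// => j _; rewrite padic_abs_ge0.
move=> n; have [nN|Nn] := ltnP n N.+1; first by rewrite ler_wpDl// le.
have := padic_absD_max p_pr (x n - x N) (x N); rewrite subrK => /le_trans.
apply; rewrite ge_max; apply/andP; split.
  by rewrite ler_wpDr// ltW// hN// ltnW.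
by rewrite ler_wpDl// le.
Qed.

Lemma padic_cauchy_subring : subring_closed (padic_cauchy p_pr).
Proof.
split.
- apply/asboolP => e e0; exists 0%N => m n _ _.
  by rewrite /= subrr padic_abs0.
- move=> x y /asboolP cx /asboolP cy; apply/asboolP => e e0.
  have [N hN] := cx _ e0; have [M hM] := cy _ e0.
  exists (maxn N M) => m n; rewrite !geq_max => /andP[Nm Mm] /andP[Nn Mn].
  rewrite [X in abs X](_ : _ = (x m - x n) - (y m - y n)); last first.
    by rewrite opprD !opprK /= !fctE; lra.
  by rewrite (le_lt_trans (padic_absB_max p_pr _ _))// gt_max hN// hM.
- move=> x y /asboolP cx /asboolP cy; apply/asboolP => e e0.
  have [A A0 hA] := padic_cauchy_bounded cx.
  have [B B0 hB] := padic_cauchy_bounded cy.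
  have [N hN] := cx (e / B) (divr_gt0 e0 B0).
  have [M hM] := cy (e / A) (divr_gt0 e0 A0).
  exists (maxn N M) => m n; rewrite !geq_max => /andP[Nm Mm] /andP[Nn Mn].
  rewrite [X in abs X](_ : _ = (x m - x n) * y m + x n * (y m - y n)); last first.
    by rewrite /= !fctE; lra.
  rewrite (le_lt_trans (padic_absD_max p_pr _ _))// gt_max !padic_absM//.
  apply/andP; split.
    have [->|y0] := eqVneq (abs (y m)) 0; first by rewrite mulr0.
    have yp : 0 < abs (y m) by rewrite lt0r y0 padic_abs_ge0.
    rewrite -ltr_pdivlMr// (lt_le_trans (hN _ _ Nm Nn))//.
    by rewrite ler_pM2l// lef_pV2.
  have [->|x0] := eqVneq (abs (x n)) 0; first by rewrite mul0r.
  have xp : 0 < abs (x n) by rewrite lt0r x0 padic_abs_ge0.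
  rewrite mulrC -ltr_pdivlMr// (lt_le_trans (hM _ _ Mm Mn))//.
  by rewrite ler_pM2l// lef_pV2.
Qed.

HB.instance Definition _ :=
  GRing.isSubringClosed.Build (nat -> rat) (padic_cauchy p_pr) padic_cauchy_subring.

Record cauchySeq := CauchySeq {
  cauchy_val :> nat -> rat;
  _ : cauchy_val \in padic_cauchy p_pr }.

HB.instance Definition _ := [isSub for cauchy_val].
HB.instance Definition _ := [Choice of cauchySeq by <:].
HB.instance Definition _ := [SubChoice_isSubComNzRing of cauchySeq by <:].

Lemma cauchySeqP (x : cauchySeq) : padic_cauchy_prop p x.
Proof. by have /asboolP := valP x. Qed.

Definition padic_null : {pred cauchySeq} := fun x => `[< padic_null_prop p x >].

Lemma padic_null_ideal : idealr_closed padic_null.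
Proof.
split.
- by apply/asboolP => e e0; exists 0%N => n _ ; rewrite /= padic_abs0.
- apply/asboolP => /(_ _ ltr01)[N /(_ _ (leqnn N))].
  by rewrite /= padic_abs1// ltxx.
- move=> a x y /asboolP nx /asboolP ny; apply/asboolP => e e0.
  have [A A0 hA] := padic_cauchy_bounded (@cauchySeqP a).
  have [N hN] := nx (e / A) (divr_gt0 e0 A0).
  have [M hM] := ny _ e0.
  exists (maxn N M) => n; rewrite !geq_max => /andP[Nn Mn].
  rewrite [X in abs X](_ : _ = a n * x n + y n)//.
  rewrite (le_lt_trans (padic_absD_max p_pr _ _))// gt_max hM// andbT.
  rewrite padic_absM//.
  have [->|a0] := eqVneq (abs (a n)) 0; first by rewrite mul0r.
  have ap : 0 < abs (a n) by rewrite lt0r a0 padic_abs_ge0.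
  rewrite mulrC -ltr_pdivlMr// (lt_le_trans (hN _ Nn))//.
  by rewrite ler_pM2l// lef_pV2.
Qed.

HB.instance Definition _ := isIdealr.Build cauchySeq padic_null padic_null_ideal.

Lemma padic_abs_eventually (x : cauchySeq) : x \notin padic_null ->
  exists N, forall n, (N <= n)%N -> x n != 0 /\ abs (x n) = abs (x N).
Proof.
move=> /asboolP nx.
have [e e0 he] : exists2 e, 0 < e & forall N, exists2 n, (N <= n)%N & e <= abs (x n).
  apply: contrapT => h; apply: nx => e e0.
  apply: contrapT => h2; apply: h; exists e => // N.
  apply: contrapT => h3; apply: h2; exists N => n Nn.
  by rewrite ltNge; apply/negP => le; apply: h3; exists n.
have [N hN] := cauchySeqP x e0.
have [m Nm em] := he N.
have H n : (N <= n)%N -> abs (x n) = abs (x m).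
  move=> Nn; apply: (padic_absB_eq p_pr); exact: lt_le_trans (hN _ _ Nn Nm) em.
exists N => n Nn; rewrite (H n)// (H N)//; split => //.
by rewrite -(padic_abs_eq0 p_pr) H// gt_eqF// (lt_le_trans e0).
Qed.

End CauchySeq.

Section Qp.
Variables (p : nat) (p_pr : prime p).

Definition Qp := {ideal_quot (@padic_null p p_pr)}.

HB.instance Definition _ := GRing.ComNzRing.on Qp.

(* |x|_p is a limit of |x_n|_p, which is eventually constant or tends to 0, so
   that |x|_p is rational. rat^o is rat with its usual topology. Qp cannot be a
   normedZmodType, for which `|x *+ n| = `|x| *+ n *)
Definition Qp_abs (x : Qp) : rat :=
  limn (fun n => padic_abs p (repr x n) : rat^o).

Local Notation null := (@padic_null p p_pr).
Local Notation abs := (padic_abs p).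


Lemma padic_abs_dist a b : `|abs a - abs b| <= abs (a - b).
Proof.
have le u v : abs u <= abs (u - v) + abs v.
  have := padic_absD_max p_pr (u - v) v; rewrite subrK => /le_trans; apply.
  by rewrite ge_max lerDl lerDr !padic_abs_ge0.
rewrite ler_norml lerBlDr le andbT lerBrDr addrC lerBlDr.
by rewrite -(padic_absN p (a - b)) opprB addrC le.
Qed.

Lemma padic_cauchy_cvg (x : cauchySeq p_pr) :
  exists l : rat^o, (abs (x n) : rat^o) @[n --> \oo] --> l.
Proof.
have [/asboolP x0|/padic_abs_eventually[N hN]] := boolP (x \in null).
  exists 0; apply/cvgrPdist_lt => e e0; have [N hN] := x0 _ e0.
  by exists N => // n /= Nn; rewrite sub0r normrN ger0_norm ?padic_abs_ge0// hN.
exists (abs (x N)); apply/cvgrPdist_lt => e e0; exists N => // n /= Nn.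
by rewrite (hN n Nn).2 subrr normr0.
Qed.

Lemma pi_Qp_eq (x y : cauchySeq p_pr) :
  (\pi_Qp x == \pi_Qp y) = (x - y \in null).
Proof. by rewrite Quotient.idealrBE. Qed.

Lemma Qp_pi_eq0 (x : cauchySeq p_pr) : (\pi_Qp x == 0) = (x \in null).
Proof. by rewrite -[0 in LHS](rmorph0 (\pi_Qp)) pi_Qp_eq subr0. Qed.

Lemma cvg_Qp_abs (x : cauchySeq p_pr) :
  (abs (x n) : rat^o) @[n --> \oo] --> (Qp_abs (\pi_Qp x) : rat^o).
Proof.
have [l hl] := padic_cauchy_cvg (repr (\pi_Qp x)).
rewrite /Qp_abs (cvg_lim _ hl); last exact: norm_hausdorff.
have /asboolP xy : x - repr (\pi_Qp x) \in null by rewrite -pi_Qp_eq reprK.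
apply/cvgrPdist_lt => e e0.
have e20 : 0 < e / 2 by rewrite divr_gt0.
move/cvgrPdist_lt : hl => /(_ _ e20)[M _ hM].
have [N hN] := xy _ e20.
exists (maxn M N) => // n /=; rewrite geq_max => /andP[Mn Nn].
rewrite -[_ - _](subrKA (abs (repr (\pi_Qp x) n))) (splitr e).
rewrite (le_lt_trans (ler_normD _ _))// ltrD//; first exact: hM.
by rewrite distrC (le_lt_trans (padic_abs_dist _ _))// hN.
Qed.

Lemma Qp_ind (P : Qp -> Prop) : (forall x : cauchySeq p_pr, P (\pi_Qp x)) -> forall x, P x.
Proof. by move=> H x; rewrite -[x]reprK. Qed.

Lemma Qp_absE (x : cauchySeq p_pr) (l : rat^o) :
  (abs (x n) : rat^o) @[n --> \oo] --> l -> Qp_abs (\pi_Qp x) = l.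
Proof. by move=> xl; apply: (cvg_unique _ (@cvg_Qp_abs x) xl). Qed.


Lemma Qp_abs_null (x : cauchySeq p_pr) : x \in null -> Qp_abs (\pi_Qp x) = 0.
Proof.
move=> /asboolP x0; apply: Qp_absE; apply/cvgrPdist_lt => e e0.
have [N hN] := x0 _ e0.
by exists N => // n /= Nn; rewrite sub0r normrN ger0_norm ?padic_abs_ge0// hN.
Qed.

Lemma Qp_abs_near (x : cauchySeq p_pr) : x \notin null ->
  exists N, forall n, (N <= n)%N -> Qp_abs (\pi_Qp x) = abs (x n) /\ x n != 0.
Proof.
move=> /padic_abs_eventually[N hN]; exists N => n Nn.
split; last exact: (hN n Nn).1.
rewrite (hN n Nn).2; apply: Qp_absE.
apply/cvgrPdist_lt => e e0; exists N => // m /= Nm.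
by rewrite (hN m Nm).2 subrr normr0.
Qed.

Lemma Qp_abs_le (x : cauchySeq p_pr) (r : rat) : 0 < r ->
  (Qp_abs (\pi_Qp x) < r) -> exists N, forall n, (N <= n)%N -> abs (x n) < r.
Proof.
move=> r0 xr; have [/asboolP x0|/Qp_abs_near[N hN]] := boolP (x \in null).
  exact: x0.
by exists N => n /hN[<-].
Qed.

Lemma Qp_abs0 : Qp_abs 0 = 0.
Proof. by rewrite -(rmorph0 (\pi_Qp)) Qp_abs_null// rpred0. Qed.

Lemma Qp_abs_eq0 x : (Qp_abs x == 0) = (x == 0).
Proof.
elim/Qp_ind: x => x; rewrite Qp_pi_eq0; have [|/Qp_abs_near[N hN]] := boolP (_ \in _).
  by move=> x0; rewrite Qp_abs_null ?eqxx.
by have [-> xN] := hN _ (leqnn N); rewrite padic_abs_eq0//; exact: negbTE.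
Qed.

Lemma Qp_abs_ge0 x : 0 <= Qp_abs x.
Proof.
elim/Qp_ind: x => x; have [|/Qp_abs_near[N hN]] := boolP (x \in null).
  by move=> x0; rewrite Qp_abs_null.
by have [-> _] := hN _ (leqnn N); rewrite padic_abs_ge0.
Qed.

Lemma Qp_absM x y : Qp_abs (x * y) = Qp_abs x * Qp_abs y.
Proof.
elim/Qp_ind: x => x; elim/Qp_ind: y => y; rewrite -rmorphM.
apply: Qp_absE.
rewrite (_ : (fun n => _) = (fun n => abs (x n) * abs (y n) : rat^o)); last first.
  by apply/funext => n; rewrite -padic_absM.
exact: cvgM (@cvg_Qp_abs x) (@cvg_Qp_abs y).
Qed.

Lemma Qp_absN x : Qp_abs (- x) = Qp_abs x.
Proof.
elim/Qp_ind: x => x; rewrite -rmorphN; apply: Qp_absE.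
rewrite (_ : (fun n => _) = (fun n => abs (x n) : rat^o)).
  exact: cvg_Qp_abs.
by apply/funext => n; rewrite -[RHS]padic_absN.
Qed.

Lemma Qp_absD_max x y : Qp_abs (x + y) <= Num.max (Qp_abs x) (Qp_abs y).
Proof.
elim/Qp_ind: x => x; elim/Qp_ind: y => y.
rewrite leNgt; apply/negP; rewrite gt_max -rmorphD => /andP[].
set r := Qp_abs (\pi_Qp (x + y)).
have [/Qp_abs_null|xy0] := boolP (x + y \in null).
  by rewrite /r => ->; rewrite ltNge Qp_abs_ge0.
move=> hx hy; have r0 : 0 < r by rewrite (le_lt_trans _ hx)// Qp_abs_ge0.
have [N hN] := Qp_abs_le r0 hx.
have [M hM] := Qp_abs_le r0 hy.
have [K /(_ (maxn K (maxn N M)))] := Qp_abs_near xy0.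
rewrite leq_maxl -/r => /(_ isT)[rE _].
have := padic_absD_max p_pr (x (maxn K (maxn N M))) (y (maxn K (maxn N M))).
by rewrite -[X in X <= _]rE leNgt gt_max hN ?hM//; lia.
Qed.

Lemma Qp_absD x y : Qp_abs (x + y) <= Qp_abs x + Qp_abs y.
Proof.
apply: le_trans (Qp_absD_max x y) _.
by rewrite ge_max lerDl lerDr !Qp_abs_ge0.
Qed.

Lemma Qp_abs_nat (m : nat) : Qp_abs m%:R = padic_abs p m%:R.
Proof.
rewrite -(rmorph_nat \pi_Qp); apply: Qp_absE.
rewrite (_ : (fun n => _) = cst (abs m%:R : rat^o)); first exact: cvg_cst.
apply/funext => n; congr (abs _).
by elim: m => [//|m IH]; rewrite -!natr1 -IH.
Qed.

Lemma padic_inv_cauchy (x : cauchySeq p_pr) : x \notin null ->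
  (fun n => (x n)^-1) \in padic_cauchy p_pr.
Proof.
move=> /padic_abs_eventually[N hN]; apply/asboolP => e e0.
have c0 : 0 < abs (x N) by rewrite padic_abs_gt0// (hN N _).1.
have [M hM] := cauchySeqP x (mulr_gt0 e0 (mulr_gt0 c0 c0)).
exists (maxn N M) => m n; rewrite !geq_max => /andP[Nm Mm] /andP[Nn Mn].
have [xm0 xmE] := hN _ Nm; have [xn0 xnE] := hN _ Nn.
have -> : (x m)^-1 - (x n)^-1 = (x n - x m) * ((x m)^-1 * (x n)^-1).
  by field; rewrite xm0 xn0.
rewrite !padic_absM// !padic_absV// xmE xnE -invfM ltr_pdivrMr ?mulr_gt0//.
exact: hM.
Qed.

Definition Qp_inv (x : Qp) : Qp :=
  if x == 0 then 0 else
  \pi_Qp (insubd (0 : cauchySeq p_pr) (fun n => (repr x n)^-1)).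

Lemma Qp_mulVf x : x != 0 -> Qp_inv x * x = 1.
Proof.
move=> x0; rewrite /Qp_inv (negbTE x0).
have xn : repr x \notin null by rewrite -Qp_pi_eq0 reprK.
set y := insubd _ _; have yE : y = (fun n => (repr x n)^-1) :> (nat -> rat).
  by rewrite /y val_insubd padic_inv_cauchy.
rewrite -[X in _ * X]reprK -rmorphM -[1](rmorph1 (\pi_Qp)); apply/eqP.
rewrite pi_Qp_eq; apply/asboolP => e e0.
have [N hN] := padic_abs_eventually xn; exists N => n Nn.
have [xn0 _] := hN _ Nn.
rewrite [X in abs X](_ : _ = y n * repr x n - 1)//.
by rewrite yE mulVf// subrr padic_abs0.
Qed.

Lemma Qp_inv0 : Qp_inv 0 = 0.
Proof. by rewrite /Qp_inv eqxx. Qed.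

HB.instance Definition _ := GRing.ComNzRing_isField.Build Qp Qp_mulVf Qp_inv0.

Lemma Qp_dist0 (x : Qp) : Qp_abs (x - x) = 0.
Proof. by rewrite subrr Qp_abs0. Qed.

Lemma Qp_dist_eq (x y : Qp) : Qp_abs (x - y) = 0 -> x = y.
Proof. by move=> /eqP; rewrite Qp_abs_eq0 subr_eq0 => /eqP. Qed.

Lemma Qp_dist_sym (x y : Qp) : Qp_abs (x - y) = Qp_abs (y - x).
Proof. by rewrite -Qp_absN opprB. Qed.

Lemma Qp_dist_triangle (y x z : Qp) :
  Qp_abs (x - z) <= Qp_abs (x - y) + Qp_abs (y - z).
Proof. by rewrite -(subrKA y x) Qp_absD. Qed.

HB.instance Definition _ := isPointed.Build Qp 0.
HB.instance Definition _ := isMetric.Build rat Qp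
  Qp_dist0 Qp_dist_eq Qp_dist_sym Qp_dist_triangle.

(* Borel sets *)
HB.instance Definition _ := @isMeasurable.Build default_measure_display Qp
  <<s @open Qp >> (@sigma_algebra0 _ setT _) (@sigma_algebraC Qp (@open Qp))
  (@sigma_algebra_bigcup _ setT _).

(* Not the library's closed_ball, the closure of the open ball of radius r:
   here the spheres are open *)
Definition padic_ball (a : Qp) (r : rat) : set Qp := [set x | Qp_abs (x - a) <= r].

Lemma measurable_padic_ball (a : Qp) (r : rat) : measurable (padic_ball a r).
Proof.
rewrite -[padic_ball a r]setCK; apply: measurableC; apply: sub_sigma_algebra.
rewrite openE => x /= /negP; rewrite -ltNge => rx.
apply/(@nbhs_ballP rat); exists (Qp_abs (x - a) - r); first by rewrite /= subr_gt0.
move=> y; rewrite ballEmdist /= ltrBrDr => h; apply/negP; rewrite -ltNge.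
rewrite -(ltrD2l (Qp_abs (x - y))) (lt_le_trans h)//.
exact: Qp_dist_triangle.
Qed.

End Qp.

(* normc is the R-valued modulus of a complex number *)
Section ComplexFun.
Context d (T : measurableType d) (R : realType).
Variables (mu : {measure set T -> \bar R}) (D : set T).
Implicit Types f g : T -> R[i].

Definition cmeasurable f :=
  measurable_fun D (fun x => complex.Re (f x)) /\
  measurable_fun D (fun x => complex.Im (f x)).

Definition cintegral f : R[i] :=
  ((\int[mu]_(x in D) complex.Re (f x)) +i* (\int[mu]_(x in D) complex.Im (f x)))%C.

Definition sqnorm_integral f : \bar R := (\int[mu]_(x in D) (normc (f x) ^+ 2)%:E)%E.

Definition L2norm f : R := Num.sqrt (fine (sqnorm_integral f)).

End ComplexFun.

Section L2.
Context d (T : measurableType d) (R : realType).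
Variables (mu : {measure set T -> \bar R}) (D : set T) (mD : measurable D).
Implicit Types f g : T -> R[i].
Local Notation cmeas := (cmeasurable D).

Definition squareIntegrable_prop f := cmeas f /\ (sqnorm_integral mu D f < +oo)%E.

Lemma normcE (z : R[i]) : normc z = Num.sqrt (complex.Re z ^+ 2 + complex.Im z ^+ 2).
Proof. by case: z. Qed.

Lemma normc_ge0 (z : R[i]) : 0 <= normc z.
Proof. by rewrite normcE sqrtr_ge0. Qed.

Lemma cmeasurableD f g : cmeas f -> cmeas g -> cmeas (f + g).
Proof.
move=> [fr fi] [gr gi]; split.
  rewrite (_ : (fun x => _) = (fun x => complex.Re (f x) + complex.Re (g x))).
    exact: measurable_funD.
  by apply/funext => x; rewrite /= -raddfD.
rewrite (_ : (fun x => _) = (fun x => complex.Im (f x) + complex.Im (g x))).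
  exact: measurable_funD.
by apply/funext => x; rewrite /= -raddfD.
Qed.

Lemma cmeasurableN f : cmeas f -> cmeas (- f).
Proof.
move=> [fr fi]; split.
  rewrite (_ : (fun x => _) = (fun x => - complex.Re (f x))).
    exact: measurableT_comp.
  by apply/funext => x; rewrite /= -raddfN.
rewrite (_ : (fun x => _) = (fun x => - complex.Im (f x))).
  exact: measurableT_comp.
by apply/funext => x; rewrite /= -raddfN.
Qed.

Lemma cmeasurableM f g : cmeas f -> cmeas g -> cmeas (f * g).
Proof.
move=> [fr fi] [gr gi]; split.
  rewrite (_ : (fun x => _) = (fun x => complex.Re (f x) * complex.Re (g x) -
      complex.Im (f x) * complex.Im (g x))).
    by apply: measurable_funB; exact: measurable_funM.
  by apply/funext => x; rewrite fctE; case: (f x) (g x) => a b [].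
rewrite (_ : (fun x => _) = (fun x => complex.Re (f x) * complex.Im (g x) +
      complex.Im (f x) * complex.Re (g x))).
  by apply: measurable_funD; exact: measurable_funM.
by apply/funext => x; rewrite fctE; case: (f x) (g x) => a b [].
Qed.

Lemma cmeasurable_cst (c : R[i]) : cmeas (cst c).
Proof. by split; exact: measurable_cst. Qed.

Lemma measurable_normc f : cmeas f -> measurable_fun D (fun x => normc (f x)).
Proof.
move=> [fr fi].
rewrite (_ : (fun x => _) = (fun x => Num.sqrt (complex.Re (f x) ^+ 2 + complex.Im (f x) ^+ 2))).
  apply: (measurableT_comp (continuous_measurable_fun (@sqrt_continuous R))).
  by apply: measurable_funD; exact: measurable_funX.
by apply/funext => x; rewrite normcE.
Qed.

Lemma measurable_sqnormc f : cmeas f -> measurable_fun D (fun x => (normc (f x) ^+ 2)%:E).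
Proof. by move=> /measurable_normc mf; apply/measurable_EFinP/measurable_funX. Qed.

Lemma sqnorm_integral_ge0 f : (0 <= sqnorm_integral mu D f)%E.
Proof. by apply: integral_ge0 => x _; rewrite lee_fin sqr_ge0. Qed.

Lemma L2norm_ge0 f : 0 <= L2norm mu D f.
Proof. by rewrite sqrtr_ge0. Qed.

Let nf f : T -> R := (fun x => normc (f x)) \_ D.

Let mnf f : cmeas f -> measurable_fun setT (nf f).
Proof. by move=> /measurable_normc mf; exact: (measurable_restrictT _ mD).1. Qed.

Lemma Lnorm_sqnorm f : ('N[mu]_2%:E[EFin \o nf f] = (sqnorm_integral mu D f) `^ (2^-1))%E.
Proof.
rewrite unlock /Lnorm /sqnorm_integral [in RHS]integral_mkcond; congr (_ `^ _)%E.
apply: eq_integral => x _; rewrite /= /nf !patchE.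
case: ifPn => _; rewrite ?normr0 ?poweR_EFin ?powR0//.
by rewrite ger0_norm ?normc_ge0// powR_mulrn// normc_ge0.
Qed.

Lemma L2normE f : (sqnorm_integral mu D f < +oo)%E ->
  ('N[mu]_2%:E[EFin \o nf f] = (L2norm mu D f)%:E)%E.
Proof.
move=> foo; rewrite Lnorm_sqnorm.
have ffin : sqnorm_integral mu D f \is a fin_num.
  by rewrite ge0_fin_numE// sqnorm_integral_ge0.
rewrite /L2norm -{1}(fineK ffin) poweR_EFin powR12_sqrt//.
by rewrite fine_ge0// sqnorm_integral_ge0.
Qed.

Lemma sqnorm_le f g (c : R) : cmeas f -> cmeas g -> 0 <= c ->
  (forall x, D x -> normc (f x) <= c * normc (g x)) ->
  (sqnorm_integral mu D f <= (c ^+ 2)%:E * sqnorm_integral mu D g)%E.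
Proof.
move=> mf mg c0 fg; rewrite -ge0_integralZl_EFin ?sqr_ge0//=; last 2 first.
- by move=> x _; rewrite lee_fin sqr_ge0.
- exact: measurable_sqnormc.
apply: ge0_le_integral => //=.
- by move=> x _; rewrite lee_fin sqr_ge0.
- exact: measurable_sqnormc.
- apply: emeasurable_funM => //; exact: measurable_sqnormc.
- move=> x Dx; rewrite -EFinM lee_fin -exprMn ler_pXn2r ?nnegrE ?normc_ge0 ?fg//.
  by rewrite mulr_ge0// normc_ge0.
Qed.

Lemma squareIntegrable_le f g (c : R) : cmeas f -> squareIntegrable_prop g ->
  0 <= c -> (forall x, D x -> normc (f x) <= c * normc (g x)) ->
  squareIntegrable_prop f.
Proof.
move=> mf [mg goo] c0 fg; split => //.
apply: (le_lt_trans (sqnorm_le mf mg c0 fg)).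
by rewrite lte_mul_pinfty ?lee_fin ?sqr_ge0.
Qed.

Lemma L2norm_triangle f g : squareIntegrable_prop f -> squareIntegrable_prop g ->
  squareIntegrable_prop (f + g) /\ L2norm mu D (f + g) <= L2norm mu D f + L2norm mu D g.
Proof.
move=> [mf foo] [mg goo].
have mfg := cmeasurableD mf mg.
have H : ('N[mu]_2%:E[EFin \o nf (f + g)%R] <= (L2norm mu D f + L2norm mu D g)%:E)%E.
  rewrite [leRHS]EFinD -(L2normE foo) -(L2normE goo).
  apply: (@le_trans _ _ 'N[mu]_2%:E[EFin \o (nf f \+ nf g)%R]%E); last first.
    by apply: minkowski_EFin => //; [exact: mnf|exact: mnf|rewrite ler1n].
  rewrite unlock /Lnorm; apply: gt0_ler_poweR; rewrite ?invr_ge0// ?in_itv/= ?leey ?andbT.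
  + by apply: integral_ge0 => x _; rewrite /= lee_fin powR_ge0.
  + by apply: integral_ge0 => x _; rewrite /= lee_fin powR_ge0.
  apply: ge0_le_integral => //=.
  + apply/measurable_EFinP; apply: (@measurableT_comp _ _ _ _ _ _ (@powR R ^~ 2)) => //.
    by apply: measurableT_comp => //; exact: mnf.
  + apply/measurable_EFinP; apply: (@measurableT_comp _ _ _ _ _ _ (@powR R ^~ 2)) => //.
    by apply: measurableT_comp => //; apply: measurable_funD; exact: mnf.
  + move=> x _; rewrite lee_fin ge0_ler_powR// ?nnegrE//.
    rewrite /nf !patchE; case: ifPn => _; last by rewrite addr0.
    rewrite !ger0_norm ?addr_ge0 ?normc_ge0//.
    exact: le_normcD.
have fgoo : (sqnorm_integral mu D (f + g)%R < +oo)%E.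
  have := le_lt_trans H (ltry _); rewrite Lnorm_sqnorm.
  apply: contraTT; rewrite -!leNgt !leye_eq => /eqP ->.
  by rewrite poweRyr// invr_eq0 pnatr_eq0.
split; first by split.
by move: H; rewrite L2normE.
Qed.

Definition squareIntegrable (_ : measurable D) : {pred T -> R[i]} :=
  fun f => `[< squareIntegrable_prop f >].

Lemma squareIntegrable_zmod_closed : zmod_closed (squareIntegrable mD).
Proof.
have opp f : squareIntegrable_prop f -> squareIntegrable_prop (- f).
  move=> hf; apply: (squareIntegrable_le _ hf ler01) => [|x _].
    by apply: cmeasurableN; case: hf.
  by rewrite mul1r fctE normcN.
split.
  apply/asboolP; split; first exact: cmeasurable_cst.
  rewrite /sqnorm_integral integral0_eq// => x _.
  by rewrite normc0 expr0n.
move=> f g /asboolP hf /asboolP hg; apply/asboolP.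
by have [] := L2norm_triangle hf (opp _ hg).
Qed.

HB.instance Definition _ := GRing.isZmodClosed.Build (T -> R[i])
  (squareIntegrable mD) squareIntegrable_zmod_closed.

Record L2fun := L2Fun {
  L2fun_val :> T -> R[i];
  _ : L2fun_val \in squareIntegrable mD }.

HB.instance Definition _ := [isSub for L2fun_val].
HB.instance Definition _ := [Choice of L2fun by <:].
HB.instance Definition _ := [SubChoice_isSubZmodule of L2fun by <:].

Lemma L2funP (f : L2fun) : squareIntegrable_prop f.
Proof. by have /asboolP := valP f. Qed.

Definition L2null : {pred L2fun} :=
  fun f : L2fun => `[< ae_eq mu D (f : T -> R[i]) (cst 0) >].

Lemma L2null_zmod_closed : zmod_closed L2null.
Proof.
split; first by apply/asboolP; exact: aeW.
move=> f g /asboolP f0 /asboolP g0; apply/asboolP.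
apply: filterS2 f0 g0 => x /= f0 g0 Dx.
transitivity (f x - g x); first by [].
by rewrite f0// g0// subr0.
Qed.

HB.instance Definition _ := GRing.isZmodClosed.Build L2fun L2null L2null_zmod_closed.

(* Square-integrable functions on D up to equality almost everywhere on D;
   an L2fun is defined on the whole of T but only its values on D matter *)
Definition L2 := Quotient.quot L2null.

HB.instance Definition _ := GRing.Zmodule.on L2.

Lemma pi_L2_eq (f g : L2fun) : (\pi_L2 f == \pi_L2 g) = (f - g \in L2null).
Proof. by rewrite Quotient.idealrBE. Qed.

Lemma pi_L2P (f g : L2fun) : \pi_L2 f = \pi_L2 g <-> ae_eq mu D f g.
Proof.
split=> [/eqP|fg].
  rewrite pi_L2_eq => /asboolP; apply: filterS => x /= h Dx; apply/eqP.
  by rewrite -subr_eq0; apply/eqP; exact: h.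
apply/eqP; rewrite pi_L2_eq; apply/asboolP; apply: filterS fg => x /= h Dx.
by transitivity (f x - g x); rewrite // h// subrr.
Qed.

Definition L2_norm (u : L2) : R := L2norm mu D (repr u).

Lemma L2norm_ae f g : cmeas f -> cmeas g -> ae_eq mu D f g -> L2norm mu D f = L2norm mu D g.
Proof.
move=> mf mg fg; congr (Num.sqrt (fine _)); apply: ae_eq_integral => //.
- exact: measurable_sqnormc.
- exact: measurable_sqnormc.
- by apply: filterS fg => x /= h Dx; rewrite h.
Qed.

Lemma L2_norm_pi (f : L2fun) : L2_norm (\pi_L2 f) = L2norm mu D f.
Proof.
apply: L2norm_ae; [exact: (L2funP _).1|exact: (L2funP _).1|].
by apply/pi_L2P; rewrite reprK.
Qed.

Lemma L2_norm_triangle (u v : L2) : L2_norm (u + v) <= L2_norm u + L2_norm v.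
Proof.
rewrite -[u]reprK -[v]reprK -raddfD !L2_norm_pi.
exact: (L2norm_triangle (L2funP _) (L2funP _)).2.
Qed.

Lemma L2_norm_eq0 (u : L2) : L2_norm u = 0 -> u = 0.
Proof.
rewrite -[u]reprK L2_norm_pi -(raddf0 \pi_L2) => u0; apply/pi_L2P.
have [mu' uoo] := L2funP (repr u).
have ufin : sqnorm_integral mu D (repr u) \is a fin_num.
  by rewrite ge0_fin_numE// sqnorm_integral_ge0.
have : sqnorm_integral mu D (repr u) = 0%E.
  rewrite -(fineK ufin); congr EFin; apply/eqP.
  move: u0 => /eqP; rewrite sqrtr_eq0 => le0.
  by rewrite eq_le le0 fine_ge0// sqnorm_integral_ge0.
rewrite /sqnorm_integral.
under eq_integral => x _ do rewrite -[(_ ^+ 2)%:E]gee0_abs ?lee_fin ?sqr_ge0//.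
move/(ae_eq_integral_abs mu mD (measurable_sqnormc mu')).
apply: filterS => x /= h Dx; apply: eq0_normc; have := h Dx.
by move=> [] /eqP; rewrite sqrf_eq0 => /eqP.
Qed.

Lemma L2_normN (u : L2) : L2_norm (- u) = L2_norm u.
Proof.
rewrite -[u]reprK -raddfN !L2_norm_pi; congr (Num.sqrt (fine _)).
by apply: eq_integral => x _; rewrite [L2fun_val _ x]/(- (repr u x)) normcN.
Qed.

Lemma L2_normMn (u : L2) n : L2_norm (u *+ n) = L2_norm u *+ n.
Proof.
rewrite -[u]reprK -raddfMn !L2_norm_pi.
have [mu' uoo] := L2funP (repr u).
have ufin : sqnorm_integral mu D (repr u) \is a fin_num.
  by rewrite ge0_fin_numE// sqnorm_integral_ge0.
transitivity (Num.sqrt (fine ((n%:R ^+ 2)%:E * sqnorm_integral mu D (repr u))%E)).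
  congr (Num.sqrt (fine _)); rewrite -ge0_integralZl_EFin ?sqr_ge0//; last 2 first.
  - by move=> x _; rewrite lee_fin sqr_ge0.
  - exact: measurable_sqnormc.
  apply: eq_integral => x _; rewrite -EFinM -exprMn; congr (_ ^+ 2)%:E.
  rewrite mulr_natl -normcMn; congr normc.
  by elim: n => [//|n IH]; rewrite !mulrS -IH.
rewrite fineM// sqrtrM ?sqr_ge0// sqrtr_sqr ger0_norm ?ler0n//.
by rewrite mulr_natl.
Qed.

HB.instance Definition _ := Num.Zmodule_isNormed.Build R L2
  L2_norm_triangle L2_norm_eq0 L2_normMn L2_normN.

Let L2dist0 (x : L2) : `|x - x| = 0. Proof. by rewrite subrr normr0. Qed.
Let L2dist_eq (x y : L2) : `|x - y| = 0 -> x = y.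
Proof. by move=> /eqP; rewrite normr_eq0 subr_eq0 => /eqP. Qed.
Let L2dist_triangle (y x z : L2) : `|x - z| <= `|x - y| + `|y - z|.
Proof. by rewrite -(subrKA y x) ler_normD. Qed.

HB.instance Definition _ := isPointed.Build L2 0.
HB.instance Definition _ := isMetric.Build R L2
  L2dist0 L2dist_eq (@distrC R L2) L2dist_triangle.
HB.instance Definition _ := NormedZmoduleMetric.Build R L2 (fun x y => distrC x y).

End L2.

(* The Haar measure of Q_p normalised by mu Z_p = 1, Z_p being the closed unit
   ball; these two conditions determine the Borel measure *)
Record haarMeasure (R : realType) (p : nat) (p_pr : prime p) := HaarMeasure {
  haar_mu :> {measure set (Qp p_pr) -> \bar R};
  haar_translation : forall (a : Qp p_pr) (E : set (Qp p_pr)), measurable E ->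
    haar_mu [set a + x | x in E] = haar_mu E;
  haar_Zp : haar_mu (padic_ball (0 : Qp p_pr) 1) = 1%E }.

Definition has_digits (p : nat) (p_pr : prime p) (N : nat) (I : Qp p_pr) :=
  exists d : 'I_N -> 'I_p, I = \sum_(k < N) (d k)%:R * p%:R ^+ k.

Section Laplacian.
Context (R : realType) (p : nat) (p_pr : prime p).
Variables (mu : haarMeasure R p_pr) (n : nat) (V : 'I_n -> Qp p_pr) (N : nat).
Implicit Types (A : 'M[R[i]]_n) (x y : Qp p_pr).

Definition vertex_ball (I : 'I_n) : set (Qp p_pr) := padic_ball (V I) (p%:R ^- N).

Definition K_N : set (Qp p_pr) := \bigcup_(I in [set: 'I_n]) vertex_ball I.

Lemma measurable_K_N : measurable K_N.
Proof.
by apply: fin_bigcup_measurable => // I _; exact: measurable_padic_ball.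
Qed.

Definition L2_KN := L2 mu measurable_K_N.

Definition kernel A x y : R[i] :=
  p%:R ^+ N * \sum_I \sum_J A I J * \1_(vertex_ball I) x * \1_(vertex_ball J) y.

Definition degree A (I : 'I_n) : R[i] := \sum_J A I J.

Definition degree_fun A x : R[i] := \sum_I degree A I * \1_(vertex_ball I) x.

Definition laplacian_fun A (u : Qp p_pr -> R[i]) x : R[i] :=
  cintegral mu K_N (fun y => kernel A x y * u y) - degree_fun A x * u x.

Lemma haar_vertex_ball I : (mu (vertex_ball I) < +oo)%E.
Proof.
have -> : vertex_ball I = [set V I + x | x in padic_ball 0 (p%:R ^- N)].
  rewrite /vertex_ball /padic_ball; apply/seteqP; split => [x /= xI|_ [x /= x0 <-]].
    by exists (x - V I); [rewrite subr0|rewrite addrC subrK].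
  by rewrite addrAC subrr add0r -[x]subr0.
rewrite haar_translation; last exact: measurable_padic_ball.
apply: (@le_lt_trans _ _ (mu (padic_ball (0 : Qp p_pr) 1))); last first.
  by rewrite haar_Zp ltry.
apply: le_measure; rewrite ?inE; try exact: measurable_padic_ball.
move=> x /= /le_trans; apply.
by rewrite invf_le1 ?exprn_gt0 ?ltr0n ?prime_gt0// exprn_ege1// ler1n prime_gt0.
Qed.

Lemma haar_K_N : (mu K_N < +oo)%E.
Proof.
have KN : K_N = \big[setU/set0]_(I < n) vertex_ball I.
  apply/seteqP; split => [x [I _ xI]|]; first by rewrite (bigD1 I)//=; left.
  apply: (big_ind (fun X => X `<=` K_N)) => [|X Y XK YK|I _ x xI].
  - exact: sub0set.
  - by rewrite subUset; split.
  - by exists I.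
suff [] : measurable K_N /\ (mu K_N < +oo)%E by [].
rewrite KN; apply: (big_ind (fun X => measurable X /\ (mu X < +oo)%E)).
- by split; [exact: measurable0|rewrite measure0 ltry].
- move=> X Y [mX Xoo] [mY Yoo]; split; first exact: measurableU.
  by apply: (le_lt_trans (measureU2 _ mX mY)); exact: lte_add_pinfty.
- by move=> I _; split; [exact: measurable_padic_ball|exact: haar_vertex_ball].
Qed.

Lemma cmeasurable_indic (D E : set (Qp p_pr)) : measurable E ->
  cmeasurable D (\1_E : Qp p_pr -> R[i]).
Proof.
move=> mE; split.
  rewrite (_ : (fun x => _) = (\1_E : Qp p_pr -> R)); first exact: measurable_indic.
  by apply/funext => x; rewrite !indicE; case: (_ \in _).
rewrite (_ : (fun x => _) = cst (0 : R)); first exact: measurable_cst.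
by apply/funext => x; rewrite !indicE; case: (_ \in _).
Qed.

Let fctME (f g : Qp p_pr -> R[i]) x : (f * g) x = f x * g x.
Proof. by []. Qed.

Lemma cmeasurable_sum (I : Type) (s : seq I) (P : pred I) (D : set (Qp p_pr))
    (F : I -> Qp p_pr -> R[i]) :
  (forall i, cmeasurable D (F i)) -> cmeasurable D (\sum_(i <- s | P i) F i).
Proof.
move=> h; apply: (big_ind (cmeasurable D)) => [|f g|i _]; last exact: h.
  exact: (@cmeasurable_cst _ _ R D 0).
exact: cmeasurableD.
Qed.

Lemma normc_sum (I : Type) (s : seq I) (P : pred I) (F : I -> R[i]) :
  normc (\sum_(i <- s | P i) F i) <= \sum_(i <- s | P i) normc (F i).
Proof.
apply: (big_ind2 (fun a b => normc a <= b)) => //; first by rewrite normc0.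
by move=> a b c e ab ce; rewrite (le_trans (le_normcD _ _))// lerD.
Qed.

Lemma cmeasurable_degree_fun A (D : set (Qp p_pr)) : cmeasurable D (degree_fun A).
Proof.
rewrite (_ : degree_fun A = \sum_I (cst (degree A I) * (\1_(vertex_ball I) : _ -> R[i]))).
  apply: cmeasurable_sum => I; apply: cmeasurableM; first exact: cmeasurable_cst.
  by apply: cmeasurable_indic; exact: measurable_padic_ball.
by apply/funext => x; rewrite fct_sumE.
Qed.

Lemma normc_degree_fun A x : normc (degree_fun A x) <= \sum_I normc (degree A I).
Proof.
apply: (le_trans (normc_sum _ _ _)); apply: ler_sum => I _.
rewrite normcM indicE; case: (_ \in _); first by rewrite normc1 mulr1.
by rewrite normc0 mulr0 normc_ge0.
Qed.

Lemma cmeasurable_kernel A x (D : set (Qp p_pr)) : cmeasurable D (kernel A x).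
Proof.
rewrite (_ : kernel A x = cst (p%:R ^+ N) * \sum_I \sum_J
    (cst (A I J * \1_(vertex_ball I) x) * (\1_(vertex_ball J) : _ -> R[i]))); last first.
  apply/funext => y; rewrite [RHS]fctME; congr (_ * _); rewrite fct_sumE.
  by apply: eq_bigr => I _; rewrite fct_sumE.
apply: cmeasurableM; first exact: cmeasurable_cst.
apply: cmeasurable_sum => I; apply: cmeasurable_sum => J.
apply: cmeasurableM; first exact: cmeasurable_cst.
by apply: cmeasurable_indic; exact: measurable_padic_ball.
Qed.

(* [kernel A x] only depends on which vertex balls contain [x] *)
Lemma kernel_integral_finite A (u : Qp p_pr -> R[i]) :
  exists H : {ffun 'I_n -> bool} -> R[i],
  (fun x => cintegral mu K_N (fun y => kernel A x y * u y)) =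
  \sum_b (cst (H b) * (\1_[set x | [ffun I => x \in vertex_ball I] = b] : _ -> R[i])).
Proof.
exists (fun b : {ffun 'I_n -> bool} => cintegral mu K_N (fun y =>
  (p%:R ^+ N * \sum_I \sum_J A I J * (b I)%:R * \1_(vertex_ball J) y) * u y)).
apply/funext => x; rewrite fct_sumE /=.
rewrite (bigD1 [ffun I => x \in vertex_ball I])//= big1 ?addr0 => [|b /eqP bx].
  rewrite fctME indicE mem_set// mulr1; congr cintegral; apply/funext => y.
  rewrite /kernel; congr (_ * _ * _); apply: eq_bigr => I _; apply: eq_bigr => J _.
  by rewrite ffunE indicE.
by rewrite fctME indicE memNset ?mulr0// => /esym.
Qed.

Lemma measurable_vertex_pattern (b : {ffun 'I_n -> bool}) :
  measurable [set x | [ffun I => x \in vertex_ball I] = b].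
Proof.
rewrite (_ : [set x | _] =
    \bigcap_(I in [set: 'I_n]) (if b I then vertex_ball I else ~` vertex_ball I)).
  apply: fin_bigcap_measurable => // I _; case: ifPn => _.
    exact: measurable_padic_ball.
  by apply: measurableC; exact: measurable_padic_ball.
apply/seteqP; split => [x /= <- I _ | x h /=].
  by rewrite ffunE; case: ifPn; rewrite ?notin_setE ?inE.
apply/ffunP => I; rewrite ffunE; have := h I Logic.I.
by case: (b I) => hx; [rewrite mem_set|rewrite memNset].
Qed.

Lemma laplacian_fun_L2 A (u : L2fun mu measurable_K_N) :
  laplacian_fun A u \in squareIntegrable mu measurable_K_N.
Proof.
have [H HE] := kernel_integral_finite A u.
apply: (@rpredB _ (squareIntegrable mu measurable_K_N)
  (fun x => cintegral mu K_N (fun y => kernel A x y * u y)) (degree_fun A * u)).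
  rewrite HE; apply: rpred_sum => b _; apply/asboolP.
  apply: (@squareIntegrable_le _ _ _ _ _ measurable_K_N _ (cst 1) (normc (H b))).
  - apply: cmeasurableM; first exact: cmeasurable_cst.
    by apply: cmeasurable_indic; exact: measurable_vertex_pattern.
  - split; first exact: cmeasurable_cst.
    rewrite /sqnorm_integral (eq_integral (cst 1%E)).
      by rewrite integral_cst; [rewrite mul1e haar_K_N|exact: measurable_K_N].
    by move=> x _; rewrite /cst (_ : normc _ = 1) ?expr1n//; exact: (@normc1 R).
  - exact: normc_ge0.
  - move=> x _; rewrite fctME normcM ler_wpM2l ?normc_ge0// indicE.
    by case: (_ \in _); rewrite ?normc1// normc0.
apply/asboolP; apply: (@squareIntegrable_le _ _ _ _ _ measurable_K_N _ u
  (\sum_I normc (degree A I))).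
- by apply: cmeasurableM; [exact: cmeasurable_degree_fun|exact: (L2funP u).1].
- exact: L2funP.
- by apply: sumr_ge0 => I _; exact: normc_ge0.
- move=> x _; rewrite fctME normcM ler_wpM2r ?normc_ge0//.
  exact: normc_degree_fun.
Qed.

(* Independent of the representative of u: see laplacianE *)
Definition laplacian A (u : L2_KN) : L2_KN :=
  \pi_L2_KN (L2Fun (laplacian_fun_L2 A (repr u))).

Lemma cintegral_ae (f g : Qp p_pr -> R[i]) : cmeasurable K_N f -> cmeasurable K_N g ->
  ae_eq mu K_N f g -> cintegral mu K_N f = cintegral mu K_N g.
Proof.
move=> [fr fi] [gr gi] fg; congr Complex; congr fine; apply: ae_eq_integral => //;
  try exact: measurable_K_N; try exact/measurable_EFinP;
  by apply: filterS fg => x /= h Dx; rewrite h.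
Qed.

Lemma laplacianE A (f : L2fun mu measurable_K_N) :
  laplacian A (\pi_L2_KN f) = \pi_L2_KN (L2Fun (laplacian_fun_L2 A f)).
Proof.
apply/pi_L2P => /=.
have fg : ae_eq mu K_N (repr (\pi_L2_KN f)) f by apply/pi_L2P; rewrite reprK.
apply: filterS (fg) => x /= h Kx; rewrite /laplacian_fun h//; congr (_ - _).
apply: cintegral_ae.
- by apply: cmeasurableM; [exact: cmeasurable_kernel|exact: (L2funP _).1].
- by apply: cmeasurableM; [exact: cmeasurable_kernel|exact: (L2funP _).1].
- by apply: filterS fg => y /= hy Ky; rewrite hy.
Qed.

End Laplacian.

(* Main.v *)
(* The Laplacian is linear in the adjacency matrix, and on a fixed u it is
   bounded by the sum of the moduli of the entries: K_N having finite measure, u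
   is integrable on it, so |L_A u (x)| <= (2 p^N ||u||_1 + |u(x)|) sum_IJ |A_IJ|
   pointwise, and the bracket is square integrable. Hence
   ||L(s) u - L(t) u|| <= C(u) sum_IJ |A_IJ(s) - A_IJ(t)|, which tends to 0. *)
Require Import Defs.
From mathcomp Require Import all_boot all_order all_algebra.
From mathcomp Require Import complex.
From mathcomp Require Import all_classical all_reals all_analysis.
From mathcomp Require Import measurable_realfun ring.
Set Implicit Arguments.
Unset Strict Implicit.
Unset Printing Implicit Defensive.
Import Order.TTheory GRing.Theory Num.Theory.
Import numFieldNormedType.Exports.
Local Open Scope classical_set_scope.
Local Open Scope ring_scope.

(** * Real-valued modulus of a complex number *)

Section Normc.
Variable R : realType.
Implicit Types z : R[i].

Lemma normr_normc z : `|z| = ((Normc.normc z)%:C)%C.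
Proof. by []. Qed.

Lemma normc_real (a : R) : 0 <= a -> Normc.normc (a%:C)%C = a.
Proof. by move=> a0; rewrite /= expr0n addr0 sqrtr_sqr ger0_norm. Qed.

Lemma normr_Re_le z : `|complex.Re z| <= Normc.normc z.
Proof. by rewrite -lecR normc_ge_Re. Qed.

Lemma normr_Im_le z : `|complex.Im z| <= Normc.normc z.
Proof.
rewrite Defs.normcE -sqrtr_sqr ler_sqrt ?addr_ge0 ?sqr_ge0//.
by rewrite lerDr sqr_ge0.
Qed.

Lemma normc_le_ReIm z : Normc.normc z <= `|complex.Re z| + `|complex.Im z|.
Proof.
rewrite Defs.normcE -[leRHS]ger0_norm ?addr_ge0// -sqrtr_sqr.
(* After squaring, the two sides differ by the cross term 2 |Re z| |Im z|. *)
rewrite ler_sqrt ?sqr_ge0// sqrrD !real_normK ?num_real// addrAC lerDl.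
by rewrite mulrn_wge0 ?mulr_ge0.
Qed.

Lemma normc_indic (T : Type) (E : set T) x : Normc.normc (\1_E x : R[i]) <= 1.
Proof. by rewrite indicE; case: (_ \in _); rewrite ?Normc.normc1 ?Normc.normc0. Qed.

End Normc.

(** * Integrals of complex functions against a bounded factor *)

Section ComplexIntegral.
Context d (T : measurableType d) (R : realType).
Variables (mu : {measure set T -> \bar R}) (D : set T) (mD : measurable D).
Implicit Types f g : T -> R[i].

Definition cintegrable f :=
  mu.-integrable D (EFin \o (fun x => complex.Re (f x))) /\
  mu.-integrable D (EFin \o (fun x => complex.Im (f x))).

Lemma cintegralB f g : cintegrable f -> cintegrable g ->
  cintegral mu D (f - g) = cintegral mu D f - cintegral mu D g.
Proof.
move=> [fr fi] [gr gi]; rewrite /cintegral.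
rewrite (_ : (\int[mu]_(x in D) complex.Re ((f - g) x)) =
  \int[mu]_(x in D) complex.Re (f x) - \int[mu]_(x in D) complex.Re (g x)).
  rewrite (_ : (\int[mu]_(x in D) complex.Im ((f - g) x)) =
    \int[mu]_(x in D) complex.Im (f x) - \int[mu]_(x in D) complex.Im (g x)) //.
  by rewrite -RintegralB//; apply: eq_Rintegral => x _; rewrite !fctE raddfB.
by rewrite -RintegralB//; apply: eq_Rintegral => x _; rewrite !fctE raddfB.
Qed.

(** On a set of finite measure L2 lies in L1: |f| is dominated by 1 + |f|^2, and the constant 1 is
    integrable there. *)
Lemma integrable_normc f : (mu D < +oo)%E -> squareIntegrable_prop mu D f ->
  mu.-integrable D (EFin \o (fun x => Normc.normc (f x))).
Proof.
move=> Doo [mf foo].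
have sqf : mu.-integrable D (fun x => (Normc.normc (f x) ^+ 2)%:E).
  apply/integrableP; split; first exact: measurable_sqnormc.
  under eq_integral => x _ do rewrite gee0_abs ?lee_fin ?sqr_ge0//.
  exact: foo.
have one : mu.-integrable D (EFin \o cst (1 : R)).
  by apply: measurable_bounded_integrable => //; exact: bounded_cst.
apply: le_integrable (integrableD mD one sqf) => //.
  exact/measurable_EFinP/measurable_normc.
move=> x _ /=; rewrite lee_fin ger0_norm ?normc_ge0//.
rewrite ger0_norm ?addr_ge0 ?sqr_ge0//.
(* Completing the square: 1 + a^2 - a = (a - 1/2)^2 + 3/4. *)
have := sqr_ge0 (Normc.normc (f x) - 2^-1).
set a := Normc.normc (f x) => h; rewrite -subr_ge0.
rewrite (_ : _ - a = (a - 2^-1) ^+ 2 + 3 / 4); last by field.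
by rewrite addr_ge0 ?divr_ge0.
Qed.

Section Dominated.
Variables (f k : T -> R[i]) (c : R).
Hypotheses (Doo : (mu D < +oo)%E) (mk : cmeasurable D k)
  (f2 : squareIntegrable_prop mu D f)
  (kc : forall x, D x -> Normc.normc (k x) <= c).

Let fi : mu.-integrable D (EFin \o (fun x => c * Normc.normc (f x))).
Proof.
exact: eq_integrable (integrableZl mD c (integrable_normc Doo f2)).
Qed.

Let kf x : D x -> Normc.normc (k x * f x) <= c * Normc.normc (f x).
Proof. by move=> Dx; rewrite Normc.normcM ler_wpM2r ?normc_ge0// kc. Qed.

Lemma cintegrableM : cintegrable (k * f).
Proof.
have [mr mi] := cmeasurableM mk f2.1.
split; (apply: le_integrable fi => //; first exact/measurable_EFinP);
  move=> x Dx /=; rewrite lee_fin (le_trans _ (ler_norm _))//;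
  apply: le_trans (kf Dx); [exact: normr_Re_le|exact: normr_Im_le].
Qed.

(** The real and imaginary parts of the integral are each bounded by c times the integral of |f|;
    adding the two bounds produces the factor 2. *)
Lemma normc_cintegralM_le : Normc.normc (cintegral mu D (k * f)) <=
  c * (2 * \int[mu]_(x in D) Normc.normc (f x)).
Proof.
have [ir ii] := cintegrableM.
apply: le_trans (normc_le_ReIm _) _; rewrite mulrCA mulr2n mulrDl mul1r.
rewrite -RintegralZl//; last exact: integrable_normc.
apply: lerD; apply: le_trans (le_normr_Rintegral mD _) _ => //;
  apply: le_Rintegral => //; rewrite -/(EFin \o _); try exact: integrable_norm;
  move=> x Dx; apply: le_trans (kf Dx); [exact: normr_Re_le|exact: normr_Im_le].
Qed.

End Dominated.
End ComplexIntegral.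

(** * Comparison of L2 norms *)

Section SquareIntegrable.
Context d (T : measurableType d) (R : realType).
Variables (mu : {measure set T -> \bar R}) (D : set T) (mD : measurable D).
Implicit Types f g : T -> R[i].

Lemma squareIntegrable_cst (c : R[i]) : (mu D < +oo)%E ->
  squareIntegrable_prop mu D (cst c).
Proof.
move=> Doo; split; first exact: cmeasurable_cst.
rewrite /sqnorm_integral (integral_cst mu mD (Normc.normc c ^+ 2)%:E).
by rewrite lte_mul_pinfty ?lee_fin ?sqr_ge0.
Qed.

Lemma L2norm_le f g (c : R) : cmeasurable D f -> squareIntegrable_prop mu D g ->
  0 <= c -> (forall x, D x -> Normc.normc (f x) <= c * Normc.normc (g x)) ->
  L2norm mu D f <= c * L2norm mu D g.
Proof.
move=> mf g2 c0 fg.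
(* [L2norm] is defined through [fine], which sends +oo to 0, so the inequality between extended
   integrals is carried over to R after both are shown finite, that of [f] by domination. *)
have finE h : squareIntegrable_prop mu D h -> sqnorm_integral mu D h \is a fin_num.
  by move=> [_ hoo]; rewrite ge0_fin_numE// sqnorm_integral_ge0.
have ffin := finE _ (squareIntegrable_le mD mf g2 c0 fg).
rewrite -[c in leRHS]ger0_norm// -sqrtr_sqr -sqrtrM ?sqr_ge0//.
rewrite ler_sqrt ?mulr_ge0 ?sqr_ge0 ?fine_ge0 ?sqnorm_integral_ge0//.
rewrite -lee_fin EFinM !fineK//; last exact: finE.
exact: (sqnorm_le mu mD mf g2.1 c0 fg).
Qed.

End SquareIntegrable.

(** * Linearity and boundedness of the Laplacian in the adjacency matrix *)

Section Laplacian.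
Context (R : realType) (p : nat) (p_pr : prime p).
Variables (mu : haarMeasure R p_pr) (n : nat) (V : 'I_n -> Qp p_pr) (N : nat).
Implicit Types (A B : 'M[R[i]]_n) (x y : Qp p_pr) (u : L2_KN mu V N).

Definition entry_norm A : R := \sum_I \sum_J Normc.normc (A I J).

Lemma entry_norm_ge0 A : 0 <= entry_norm A.
Proof. by apply: sumr_ge0 => I _; apply: sumr_ge0 => J _; exact: normc_ge0. Qed.

Lemma kernelB A B x y :
  Defs.kernel V N (A - B) x y = Defs.kernel V N A x y - Defs.kernel V N B x y.
Proof.
rewrite /Defs.kernel -mulrBr; congr (_ * _); rewrite -sumrB; apply: eq_bigr => I _.
by rewrite -sumrB; apply: eq_bigr => J _; rewrite !mxE !mulrBl.
Qed.

Lemma degree_funB A B x :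
  degree_fun V N (A - B) x = degree_fun V N A x - degree_fun V N B x.
Proof.
rewrite /degree_fun -sumrB; apply: eq_bigr => I _; rewrite -mulrBl; congr (_ * _).
by rewrite /degree -sumrB; apply: eq_bigr => J _; rewrite !mxE.
Qed.

(** Each entry of [A] is weighted by a product of two indicators, of modulus at most 1. *)
Lemma normc_kernel_le A x y :
  Normc.normc (Defs.kernel V N A x y) <= Normc.normc (p%:R ^+ N : R[i]) * entry_norm A.
Proof.
rewrite /Defs.kernel Normc.normcM ler_wpM2l ?normc_ge0//.
apply: (le_trans (normc_sum _ _ _)); apply: ler_sum => I _.
apply: (le_trans (normc_sum _ _ _)); apply: ler_sum => J _.
rewrite !Normc.normcM -mulrA ler_piMr ?normc_ge0//.
by rewrite mulr_ile1 ?normc_ge0 ?normc_indic.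
Qed.

Lemma normc_degree_fun_le A x : Normc.normc (degree_fun V N A x) <= entry_norm A.
Proof.
apply: (le_trans (normc_degree_fun _ _ _ _)); apply: ler_sum => I _.
exact: normc_sum.
Qed.

(** Splitting the integral of a difference in [laplacian_funB] requires both integrands to be
    integrable. *)
Let cintegrable_kernelM A x (f : L2fun mu (measurable_K_N V N)) :
  cintegrable mu (K_N V N) (Defs.kernel V N A x * f).
Proof.
apply: cintegrableM; [exact: measurable_K_N|exact: haar_K_N|
  exact: cmeasurable_kernel|exact: L2funP|].
by move=> y _; exact: normc_kernel_le.
Qed.

Lemma laplacian_funB A B (f : L2fun mu (measurable_K_N V N)) x :
  laplacian_fun mu V N (A - B) f x =
  laplacian_fun mu V N A f x - laplacian_fun mu V N B f x.
Proof.
rewrite /laplacian_fun degree_funB.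
rewrite (_ : (fun y => _) = Defs.kernel V N A x * f - Defs.kernel V N B x * f); last first.
  by apply/funext => y; rewrite kernelB mulrBl.
rewrite (cintegralB (measurable_K_N V N) (cintegrable_kernelM A x f)
  (cintegrable_kernelM B x f)).
by ring.
Qed.

Lemma laplacianB A B u : laplacian (A - B) u = laplacian A u - laplacian B u.
Proof.
(* All three Laplacians are computed on the same representative [repr u], so the identity holds at
   every point. *)
rewrite /laplacian -raddfB; apply/pi_L2P/aeW => x _.
exact: laplacian_funB.
Qed.

Lemma laplacian_bounded u : exists2 C : R, 0 <= C &
  forall A, `|laplacian A u| <= C * entry_norm A.
Proof.
set f : L2fun mu (measurable_K_N V N) := repr u.
pose a := Normc.normc (p%:R ^+ N : R[i]).
(* [M] bounds the integral term of the Laplacian, up to the factor [entry_norm A], uniformly in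
   [x]. *)
pose M := a * (2 * \int[mu]_(x in K_N V N) Normc.normc (f x)).
have M0 : 0 <= M.
  by rewrite mulr_ge0 ?normc_ge0// mulr_ge0// Rintegral_ge0// => x _; exact: normc_ge0.
pose nf x : R[i] := ((Normc.normc (f x))%:C)%C.
have nfE x : Normc.normc (nf x) = Normc.normc (f x) by rewrite normc_real ?normc_ge0.
have nf2 : squareIntegrable_prop mu (K_N V N) nf.
  apply: (squareIntegrable_le (measurable_K_N V N) _ (L2funP f) ler01).
    split; last exact: measurable_cst.
    exact: measurable_normc (L2funP f).1.
  by move=> x _; rewrite mul1r nfE.
(* The majorant M + |f| is real and nonnegative, hence equal to its own modulus; it is embedded in
   [R[i]] to use the L2 theory of complex functions. Its norm is the constant [C], independent of
   [A]. *)
pose g := cst (M%:C)%C + nf.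
have g2 : squareIntegrable_prop mu (K_N V N) g.
  apply: (L2norm_triangle (measurable_K_N V N) _ nf2).1.
  by apply: squareIntegrable_cst; [exact: measurable_K_N|exact: haar_K_N].
have gE x : Normc.normc (g x) = M + Normc.normc (f x).
  rewrite -[RHS]normc_real ?addr_ge0 ?normc_ge0//.
  by congr Normc.normc; rewrite rmorphD.
exists (L2norm mu (K_N V N) g) => [|A]; first exact: L2norm_ge0.
rewrite mulrC -[leLHS]/(L2_norm _) L2_norm_pi.
have /asboolP[lm _] := laplacian_fun_L2 A f.
apply: L2norm_le => //; [exact: measurable_K_N|exact: entry_norm_ge0|].
move=> x _; rewrite gE /laplacian_fun.
apply: le_trans (le_normcD _ _) _; rewrite normcN mulrDr; apply: lerD.
  (* Regrouping exposes [a * entry_norm A], the uniform bound on the kernel. *)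
  rewrite [leRHS]mulrCA mulrA.
  apply: normc_cintegralM_le; [exact: measurable_K_N|exact: haar_K_N|
    exact: cmeasurable_kernel|exact: L2funP|].
  by move=> y _; exact: normc_kernel_le.
by rewrite Normc.normcM ler_wpM2r ?normc_ge0// normc_degree_fun_le.
Qed.

End Laplacian.

(** * Continuity in time *)

Lemma unif_continuous_continuous (U W : uniformType) (f : U -> W) :
  unif_continuous f -> continuous f.
Proof.
move=> fu x; apply/cvg_entourageP => E /fu fE.
(* The section at [x] of the entourage given by uniform continuity is a neighbourhood of [x]. *)
by apply: filterS (nbhs_entourage x fE) => y /xsectionP.
Qed.

Theorem theorem2p11 (R : realType) (p : nat) (p_pr : prime p)
    (mu : haarMeasure R p_pr)
    (n N : nat) (V : 'I_n -> Qp p_pr)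
    (V_inj : injective V)
    (V_digits : forall I : 'I_n, has_digits N (V I))
    (V_disjoint : trivIset [set: 'I_n] (vertex_ball V N))
    (A : R -> 'M[R[i]]_n)
    (A_sym : forall t : R, 0 <= t -> (A t)^T = A t)
    (A_uc : forall I J : 'I_n,
       unif_continuous ((fun t => A t I J) : subspace `[0, +oo[ -> R[i]^o)) :
  forall u : L2_KN mu V N,
    {within `[0, +oo[, continuous (fun t : R => laplacian (A t) u)}.
Proof.
move=> u s; have [C C0 hC] := laplacian_bounded u.
(* Here [s] is any real: outside the half-line its subspace filter is the principal one at [s]. The
   argument treats both cases alike. *)
have FF : Filter (nbhs (s : subspace `[0, +oo[)) := nbhs_filter _.
apply/cvgrPdist_le => e e0.
have Alim : entry_norm (A s - A t) @[t --> (s : subspace `[0, +oo[)] --> (0 : R).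
  (* The limit 0 is written as a double sum to match [entry_norm], so that convergence can be
     checked entry by entry. *)
  rewrite [X in _ --> X](_ : _ = \sum_(I < n) \sum_(J < n) (0 : R)); last first.
    by rewrite big1// => I _; rewrite big1.
  apply: cvg_big => [|I _]; first exact: add_continuous.
  apply: cvg_big => [|J _]; first exact: add_continuous.
  apply/cvgrPdist_lt => d d0.
  have := @unif_continuous_continuous _ _ _ (A_uc I J) s.
  (* The norm of [R[i]^o] takes values in [R[i]], so the real tolerance [d] enters as a complex
     number and the estimate is then read back in [R]. *)
  move=> /cvgrPdist_lt/(_ (d%:C)%C); rewrite ltcR => /(_ d0).
  apply: filterS => t; rewrite normr_normc ltcR sub0r normrN ger0_norm ?normc_ge0//.
  by rewrite !mxE.
have : C * entry_norm (A s - A t) @[t --> (s : subspace `[0, +oo[)] --> (0 : R).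
  by rewrite -[X in _ --> X](mulr0 C); apply: cvgMr.
move=> /cvgrPdist_le/(_ e e0); apply: filterS => t.
(* By linearity the increment is the Laplacian of [A s - A t] at [u], to which the bound with the
   constant [C] applies. *)
rewrite sub0r normrN => h; rewrite -laplacianB; apply: le_trans (hC _) _.
exact: le_trans (ler_norm _) h.
Qed.
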